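(* For every $n\in\mathbb{N}$ there exists a finite set $S$ and a $4$-wise uniform generator $G:S\to\{0,1\}^{2^n}$ such that for each $s\in S$ there is a circuit $C_s$ of size $O(n^2)$ (with an absolute implied constant) satisfying $C_s(x)=G(s)_x$ for every $x\in[2^n]$ (where indices $x\in[2^n]$ are identified with $n$-bit binary strings, which are the inputs to $C_s$).
   Context: A distribution $D$ over $\{0,1\}^N$ is $k$-wise uniform if for every set $T\subseteq[N]$ of size $k$, the marginal distribution of $x_T$ for $x\sim D$ is uniform over $\{0,1\}^k$. A function $G:S\to\{0,1\}^N$ is a $k$-wise uniform generator if the distribution of $G(s)$ for $s$ uniform in $S$ is $k$-wise uniform. Circuits have gates computing arbitrary Boolean functions of fan-in 2, arbitrary depth, and size is the number of gates. *)

(* Defs.v *)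
From mathcomp Require Import all_boot all_order all_algebra.

Set Implicit Arguments.
Unset Strict Implicit.
Unset Printing Implicit Defensive.

Import Order.TTheory GRing.Theory Num.Theory.

Local Open Scope ring_scope.

Record distr (R : numFieldType) (A : finType) := Distr {
  pmf :> A -> R;
  pmf_ge0 : forall a, 0 <= pmf a;
  pmf_sum1 : \sum_a pmf a = 1 }.

Section Distr.
Variable R : numFieldType.

Lemma uniform_subproof1 (A : finType) (a : A) : 0 <= (#|A|%:R^-1 : R).
Proof. by rewrite invr_ge0 ler0n. Qed.

Lemma uniform_subproof2 (A : finType) (A0 : (0 < #|A|)%N) :
  \sum_(a : A) (#|A|%:R^-1 : R) = 1.
Proof.
have cA : (#|A|%:R : R) != 0 by rewrite pnatr_eq0 -lt0n.
by rewrite sumr_const -[LHS]mulr_natr mulVf.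
Qed.

Definition uniform (A : finType) (A0 : (0 < #|A|)%N) : distr R A :=
  Distr (@uniform_subproof1 A) (uniform_subproof2 A0).

Variables (A B : finType) (f : A -> B) (D : distr R A).

Lemma law_subproof1 (b : B) : 0 <= \sum_(a | f a == b) D a.
Proof. by apply: sumr_ge0 => a _; apply: pmf_ge0. Qed.

Lemma law_subproof2 : \sum_b \sum_(a | f a == b) D a = 1.
Proof. by rewrite -(pmf_sum1 D) (partition_big f predT). Qed.

(* The distribution of f a for a drawn from D. *)
Definition law : distr R B := Distr law_subproof1 law_subproof2.

End Distr.

Definition restrict (N : nat) (T : {set 'I_N}) (x : {ffun 'I_N -> bool}) :
    {ffun {i : 'I_N | i \in T} -> bool} :=
  [ffun i => x (val i)].

Lemma cube_gt0 (I : finType) : (0 < #|{ffun I -> bool}|)%N.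
Proof. by apply/card_gt0P; exists [ffun=> false]. Qed.

(* The coordinates of x_T are indexed by T itself instead of by {0, .., k-1}. *)
Definition kwise_uniform (R : numFieldType) (N k : nat)
    (D : distr R {ffun 'I_N -> bool}) : Prop :=
  forall T : {set 'I_N}, #|T| = k ->
    law (restrict T) D =1 uniform R (cube_gt0 {i : 'I_N | i \in T}).

(* Rational weights suffice, since the law of G is that of a function of a
   uniform element of a finite set. *)
Definition kwise_uniform_generator (N k : nat) (S : finType)
    (S0 : (0 < #|S|)%N) (G : S -> {ffun 'I_N -> bool}) : Prop :=
  kwise_uniform k (law G (uniform rat S0)).

Local Open Scope nat_scope.

(* In a circuit with n inputs, wires 0, .., n-1 carry the inputs and wire n+j
   carries the output of the j-th gate; a gate may only read earlier wires.
   There are no free constants. *)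
Record gate := Gate {
  gate_fun : bool -> bool -> bool;
  gate_in1 : nat;
  gate_in2 : nat }.

Fixpoint gates_wf (m : nat) (gs : seq gate) : bool :=
  if gs is g :: gs' then
    [&& gate_in1 g < m, gate_in2 g < m & gates_wf m.+1 gs']
  else true.

Record circuit (n : nat) := Circuit {
  circuit_gates : seq gate;
  circuit_out : nat;
  circuit_gates_wf : gates_wf n circuit_gates;
  circuit_out_wf : circuit_out < n + size circuit_gates }.

Definition circuit_size (n : nat) (C : circuit n) : nat :=
  size (circuit_gates C).

Definition gate_step (v : seq bool) (g : gate) : seq bool :=
  rcons v (gate_fun g (nth false v (gate_in1 g)) (nth false v (gate_in2 g))).

Definition circuit_eval (n : nat) (C : circuit n) (x : n.-tuple bool) : bool :=
  nth false (foldl gate_step x (circuit_gates C)) (circuit_out C).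

(* Binary expansion, least significant bit first. *)
Definition bits (n : nat) (x : 'I_(2 ^ n)) : n.-tuple bool :=
  [tuple odd (x %/ 2 ^ i) | i < n].

(* Main.v *)
(** The generator outputs the truth table of a uniformly random polynomial of
    degree at most 2 over F_2 in the n index bits; the naive circuit summing its
    n^2 + 1 monomials has O(n^2) gates. The truth table is additive in the
    coefficients, so its restriction to a set of 4 points is uniform as soon as
    it is onto, and for this it suffices that each point p can be separated from
    three others: a product of two affine forms equal to 1 at p does it, since
    an affine form can vanish at any two points distinct from p. *)

Require Import Defs.
From mathcomp Require Import all_boot all_order all_algebra.

Set Implicit Arguments.
Unset Strict Implicit.
Unset Printing Implicit Defensive.

Import GRing.Theory Num.Theory.

Section Uniform.
Local Open Scope ring_scope.

Lemma law_comp (R : numFieldType) (A B C : finType) (f : A -> B) (g : B -> C)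
    (D : distr R A) : law g (law f D) =1 law (g \o f) D.
Proof.
move=> c /=; rewrite (partition_big f (fun b => g b == c)) //=.
apply: eq_bigr => b /eqP gb; apply: eq_bigl => a.
by case: eqP => [->|]; rewrite ?gb ?eqxx ?andbF.
Qed.

(** Counting [A] by fibres gives |A| = |B| |fibre|, so each value has mass |fibre| / |A| = 1 /
    |B|. *)
Lemma law_uniform_fibers (R : numFieldType) (A B : finType) (f : A -> B)
    (A0 : (0 < #|A|)%N) (B0 : (0 < #|B|)%N) :
  (forall b b', #|[pred a | f a == b]| = #|[pred a | f a == b']|) ->
  law f (uniform R A0) =1 uniform R B0.
Proof.
move=> fib b /=; rewrite sumr_const.
have cA : #|A| = (#|B| * #|[pred a | f a == b]|)%N.
  rewrite -sum_nat_const -sum1_card (partition_big f predT) //=.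
  by apply: eq_bigr => b' _; rewrite sum1_card; apply: fib.
have {}A0 : (0 < #|B| * #|[pred a | f a == b]|)%N by rewrite -cA.
move: A0; rewrite muln_gt0 => /andP[_ F0].
rewrite [X in _ *+ X](_ : _ = #|[pred a | f a == b]|); last exact: eq_card.
rewrite cA natrM invfM -[LHS]mulr_natr mulfVK //.
by rewrite pnatr_eq0 -lt0n.
Qed.

(** If [f t = b' - b], translation by [t] carries the fibre over [b] bijectively onto the fibre over
    [b']. *)
Lemma law_uniform_additive (R : numFieldType) (I J : finType)
    (f : {ffun I -> bool} -> {ffun J -> bool})
    (I0 : (0 < #|{ffun I -> bool}|)%N) (J0 : (0 < #|{ffun J -> bool}|)%N) :
  {morph f : s t / s + t} -> (forall b, exists s, f s = b) ->
  law f (uniform R I0) =1 uniform R J0.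
Proof.
move=> fD fS; apply: law_uniform_fibers => b b'.
have [t ft] := fS (b' - b).
rewrite -(card_imset _ (addIr t)) //; apply: eq_card => s.
apply/imsetP/idP => [[a /eqP fa ->]|/eqP fs].
  by rewrite inE fD fa ft addrC subrK.
exists (s - t); rewrite ?subrK // inE; apply/eqP.
by apply: (addIr (f t)); rewrite -fD subrK fs ft addrC subrK.
Qed.

End Uniform.

Section QuadraticForms.
Local Open Scope ring_scope.
Variable n : nat.
Implicit Types (x p q : n.-tuple bool) (m : option ('I_n * 'I_n)).

(* Squares [Some (i, i)] are the linear monomials, as booleans are idempotent. *)
Definition monomial m x : bool :=
  if m is Some (i, j) then tnth x i && tnth x j else true.

(** The ring structure on [bool] is that of F_2: [+] is exclusive or, [*] is conjunction. The pairs
    (i, j) and (j, i) index the same monomial. *)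
Definition quadratic_poly (s : {ffun option ('I_n * 'I_n) -> bool}) x : bool :=
  \sum_m s m * monomial m x.

Definition quadratic (f : n.-tuple bool -> bool) : Prop :=
  exists s, quadratic_poly s =1 f.

Lemma quadratic_polyD s t x :
  quadratic_poly (s + t) x = quadratic_poly s x + quadratic_poly t x.
Proof.
by rewrite -big_split /=; apply: eq_bigr => m _; rewrite ffunE mulrDl.
Qed.

Lemma quadratic_poly_sum (I : Type) (r : seq I) (P : pred I) F x :
  quadratic_poly (\sum_(i <- r | P i) F i) x =
  \sum_(i <- r | P i) quadratic_poly (F i) x.
Proof.
apply: (big_morph (fun s => quadratic_poly s x)) => [s t|].
  exact: quadratic_polyD.
by apply: big1 => m _; rewrite ffunE mul0r.
Qed.

Lemma eq_quadratic f g : f =1 g -> quadratic f -> quadratic g.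
Proof. by move=> fg [s sf]; exists s => x; rewrite sf fg. Qed.

Lemma quadraticD f g :
  quadratic f -> quadratic g -> quadratic (fun x => f x + g x).
Proof.
by move=> [s sf] [t tg]; exists (s + t) => x; rewrite quadratic_polyD sf tg.
Qed.

Lemma quadratic_monomial (c : bool) m : quadratic (fun x => c * monomial m x).
Proof.
exists [ffun m' => if m' == m then c else 0] => x.
rewrite /quadratic_poly (bigD1 m) //= ffunE eqxx big1 ?addr0 // => m' m'm.
by rewrite ffunE (negbTE m'm) mul0r.
Qed.

(** Expand: x_i x_k + b x_i + a x_k + a b. *)
Lemma quadratic_mul_affine i k (a b : bool) :
  quadratic (fun x => (tnth x i + a) * (tnth x k + b)).
Proof.
pose h c1 m1 c2 m2 c3 m3 c4 m4 x := c1 * monomial m1 x + c2 * monomial m2 x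
  + (c3 * monomial m3 x + c4 * monomial m4 x).
apply: (@eq_quadratic (h true (Some (i, k)) b (Some (i, i))
  a (Some (k, k)) (a && b) None)).
  by move=> x; rewrite /h /=; case: (tnth x i) (tnth x k) a b => [] [] [] [].
by apply: quadraticD; apply: quadraticD; apply: quadratic_monomial.
Qed.

Lemma tnth_neq x p : x != p -> exists i, tnth x i != tnth p i.
Proof.
move=> xp; apply/existsP; rewrite -negb_forall; apply: contra xp.
by move=> /forallP xp; apply/eqP/eq_from_tnth => i; apply/eqP.
Qed.

Lemma neq_negb (a b : bool) : a != b -> a = ~~ b.
Proof. by case: a b => [] []. Qed.

(* The product of an affine form vanishing at q1 and q2 with one vanishing at
   q3. If p + q1 and p + q2 share no nonzero coordinate, the first form adds
   one coordinate from each of their supports. *)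
Lemma quadratic_separation p q1 q2 q3 :
  q1 != p -> q2 != p -> q3 != p ->
  exists2 f, quadratic f & [/\ f p, ~~ f q1, ~~ f q2 & ~~ f q3].
Proof.
move=> /tnth_neq[i qi] /tnth_neq[j qj] /tnth_neq[k qk].
have [common|/existsPn disjoint] :=
    boolP [exists l, (tnth q1 l != tnth p l) && (tnth q2 l != tnth p l)].
  have [l /andP[ql1 ql2]] := existsP common.
  (* The factor x_l + p_l + 1 is 1 exactly where [x] agrees with [p] at [l], so it kills both [q1]
     and [q2]. *)
  exists (fun x => (tnth x l + ~~ tnth p l) * (tnth x k + ~~ tnth p k)).
    exact: quadratic_mul_affine.
  rewrite (neq_negb ql1) (neq_negb ql2) (neq_negb qk).
  by case: (tnth p l) (tnth p k) (tnth q1 k) (tnth q2 k) (tnth q3 l)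
    => [] [] [] [] [].
(* This is (x_i + x_j + p_i + p_j + 1)(x_k + p_k + 1), distributed into two products of affine forms
   in one variable each. *)
exists (fun x => (tnth x i + ~~ tnth p i) * (tnth x k + ~~ tnth p k)
           + (tnth x j + tnth p j) * (tnth x k + ~~ tnth p k)).
  by apply: quadraticD; apply: quadratic_mul_affine.
move: (disjoint i) (disjoint j); rewrite qi qj andbT /= => /negPn/eqP-> /negPn/eqP->.
rewrite (neq_negb qi) (neq_negb qj) (neq_negb qk).
by case: (tnth p i) (tnth p j) (tnth p k) (tnth q1 k) (tnth q2 k) (tnth q3 i)
  (tnth q3 j) => [] [] [] [] [] [] [].
Qed.

End QuadraticForms.

Section Circuits.
Variable n : nat.
Hypothesis n_gt0 : 0 < n.

Definition computable (k : nat) (f : n.-tuple bool -> bool) : Prop :=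
  exists2 C : circuit n, circuit_size C = k & circuit_eval C =1 f.

Lemma gates_wf_cat m gs hs :
  gates_wf m (gs ++ hs) = gates_wf m gs && gates_wf (m + size gs) hs.
Proof.
elim: gs m => [|g gs IH] m /=; first by rewrite addn0.
by rewrite IH addSnnS !andbA.
Qed.

Lemma size_foldl_gate_step v gs :
  size (foldl gate_step v gs) = size v + size gs.
Proof.
elim: gs v => [|g gs IH] v /=; first by rewrite addn0.
by rewrite IH size_rcons addSnnS.
Qed.

Lemma nth_foldl_gate_step v gs i :
  i < size v -> nth false (foldl gate_step v gs) i = nth false v i.
Proof.
elim: gs v => //= g gs IH v iv.
by rewrite IH ?size_rcons ?nth_rcons ?iv // ltnW.
Qed.

(** Even a constant gate must read existing wires; [n_gt0] provides wire 0. *)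
Lemma computable_const b : computable 1 (fun=> b).
Proof.
have wf : gates_wf n [:: Gate (fun _ _ => b) 0 0] by rewrite /= n_gt0.
have out : n < n + size [:: Gate (fun _ _ => b) 0 0] by rewrite addn1.
exists (Circuit wf out) => // x.
by rewrite /circuit_eval /= nth_rcons size_tuple ltnn eqxx.
Qed.

(** Two gates are appended: [h2] on the inputs [i] and [j], then [h1] on the old output and that new
    wire. Appending leaves earlier wires unchanged. *)
Lemma computable_step k f (h1 h2 : bool -> bool -> bool) (i j : 'I_n) :
  computable k f ->
  computable k.+2 (fun x => h1 (f x) (h2 (tnth x i) (tnth x j))).
Proof.
move=> [[gs out wf outP] /= sz ev].
rewrite /circuit_size /= in sz.
pose hs := [:: Gate h2 i j; Gate h1 out (n + size gs)].
have wf' : gates_wf n (gs ++ hs).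
  by rewrite gates_wf_cat wf /= !ltn_addr ?ltn_ord //= leqW //= ltnSn.
have out' : (n + size gs).+1 < n + size (gs ++ hs).
  by rewrite size_cat addnA /= addn2.
exists (Circuit wf' out'); first by rewrite /circuit_size /= size_cat sz addn2.
move=> x; rewrite -(ev x) /circuit_eval /= foldl_cat /=.
set v := foldl _ _ _.
have sv : size v = n + size gs by rewrite size_foldl_gate_step size_tuple.
have vE (l : 'I_n) : nth false v l = tnth x l.
  by rewrite nth_foldl_gate_step ?size_tuple // (tnth_nth false).
rewrite /gate_step /= !nth_rcons !size_rcons sv ltnn eqxx outP ltnn eqxx.
by rewrite !vE.
Qed.

(** One gate for the empty sum, then two for each of the n^2 + 1 monomials. *)
Lemma computable_quadratic_poly (s : {ffun option ('I_n * 'I_n) -> bool}) :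
  computable (2 * (n * n).+1).+1 (quadratic_poly s).
Proof.
have -> : (n * n).+1 = size (index_enum (option ('I_n * 'I_n))).
  by rewrite -[index_enum _]enumT -cardT card_option card_prod card_ord.
rewrite /quadratic_poly; elim: (index_enum _) => [|m r [C sz ev]].
  have [C sz ev] := computable_const false.
  by exists C => // x; rewrite ev big_nil.
have C' : computable (2 * size r).+1 (fun x => \sum_(m <- r) s m * monomial m x)%R.
  by exists C.
have [i [j [h hE]]] : exists i j (h : bool -> bool -> bool),
    forall x, h (tnth x i) (tnth x j) = (s m * monomial m x)%R.
  case: m => [[i j]|]; first by exists i, j, (fun a b => s (Some (i, j)) * (a && b))%R.
  (* The constant monomial is a gate that reads input 0 twice and ignores it. *)
  by exists (Ordinal n_gt0), (Ordinal n_gt0), (fun _ _ => s None * true)%R.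
have [D szD evD] := computable_step (fun a b => b + a)%R h i j C'.
exists D; first by rewrite szD /= mulnS.
by move=> x; rewrite evD hE big_cons.
Qed.

End Circuits.

Lemma bits_inj n : injective (@bits n).
Proof.
move=> x y xy; apply: val_inj => /=.
have {xy} : forall i, i < n -> odd (x %/ 2 ^ i) = odd (y %/ 2 ^ i).
  move=> i lt_in; have := congr1 (fun t => tnth t (Ordinal lt_in)) xy.
  by rewrite !tnth_mktuple.
case: x y => [x xn] [y yn] /=.
(* Bit 0 is the remainder modulo 2, and the remaining bits are those of the quotient by 2. *)
elim: n x y xn yn => [|n IH] x y; first by rewrite expn0 !ltnS !leqn0 => /eqP-> /eqP->.
rewrite expnSr -!ltn_divLR // => xn yn xy.
rewrite (divn_eq x 2) (divn_eq y 2) !modn2.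
have := xy 0 isT; rewrite expn0 !divn1 => ->.
by rewrite (IH _ _ xn yn) // => i lt_in; rewrite -!divnMA -expnS xy.
Qed.


Theorem theorem2p3 :
  exists c : nat, forall n : nat, 0 < n ->
    exists (S : finType) (S0 : 0 < #|S|) (G : S -> {ffun 'I_(2 ^ n) -> bool}),
      kwise_uniform_generator 4 S0 G /\
      forall s : S, exists C : circuit n,
        circuit_size C <= c * n ^ 2 /\
        forall x : 'I_(2 ^ n), circuit_eval C (bits x) = G s x.
Proof.
(* The circuits have 2 (n^2 + 1) + 1 = 2 n^2 + 3 gates, at most 5 n^2 since n is positive. *)
exists 5 => n n_gt0; exists {ffun option ('I_n * 'I_n) -> bool}, (cube_gt0 _).
exists (fun s => [ffun x => quadratic_poly s (bits x)]); split=> [T cT b|s].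
  rewrite law_comp; apply: law_uniform_additive => {b} [s t|b].
    by apply/ffunP => i; rewrite !ffunE quadratic_polyD.
  have sep (p : {i | i \in T}) : exists s, forall i : {i | i \in T},
      quadratic_poly s (bits (val i)) = (i == p).
    have : size (enum (T :\ val p)) = 3.
      by apply/eqP; rewrite -cardE -eqSS -cT (cardsD1 (val p) T) (valP p).
    case Tp: (enum _) => [|q1 [|q2 [|q3 []]]] // _.
    have {}Tp q : (q \in T :\ val p) = (q \in [:: q1; q2; q3]).
      by rewrite -Tp mem_enum.
    have neq q : q \in T :\ val p -> bits q != bits (val p).
      by rewrite !inE (inj_eq (@bits_inj n)) => /andP[].
    have [|||f [s sf] [fp fq1 fq2 fq3]] :=
      @quadratic_separation n (bits (val p)) (bits q1) (bits q2) (bits q3).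
    - by apply: neq; rewrite Tp !inE eqxx.
    - by apply: neq; rewrite Tp !inE eqxx ?orbT.
    - by apply: neq; rewrite Tp !inE eqxx ?orbT.
    exists s => i; rewrite sf; have [->|ip] := eqVneq i p; first exact: fp.
    have : val i \in T :\ val p by rewrite !inE (inj_eq val_inj) ip (valP i).
    by rewrite Tp !inE => /or3P[] /eqP->; apply/negbTE.
  have {sep} [s sE] : exists s, forall p i : {i | i \in T},
      quadratic_poly (s p) (bits (val i)) = (i == p).
    exact: (fin_all_exists sep).
  (* Interpolation: on [T], [s p] evaluates to the indicator of [p], so summing over the points
     where [b] is true gives [b]. *)
  exists (\sum_(p | b p) s p)%R; apply/ffunP => i; rewrite !ffunE.
  rewrite quadratic_poly_sum big_mkcond (bigD1 i) //= sE eqxx big1 => [|p pi].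
    by case: (b i).
  by rewrite sE eq_sym (negbTE pi) if_same.
have [C szC evC] := computable_quadratic_poly n_gt0 s.
exists C; split=> [|x]; last by rewrite evC ffunE.
have n2_gt0 : 0 < n ^ 2 by rewrite expn_gt0 n_gt0.
rewrite szC mulnn mulnS -addSn -[5]/(3 + 2) mulnDl leq_add2r.
by rewrite -{1}[3]muln1 leq_mul2l.
Qed.
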